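(* If $f(z,w)$ is a rational function which is bounded and analytic on the bidisk $\mathbb{D}^2=\{(z,w)\in\mathbb{C}^2:|z|,|w|<1\}$, then the partial derivatives $\partial f/\partial z$ and $\partial f/\partial w$ belong to the Hardy space $H^1(\mathbb{D}^2)$.
   Context: For $\mathfrak{p}\in(0,\infty]$, $H^{\mathfrak{p}}(\mathbb{D}^2)$ is the space of analytic $f:\mathbb{D}^2\to\mathbb{C}$ with $\sup_{0<r<1}\|f_r\|_{L^{\mathfrak{p}}(\mathbb{T}^2)}<\infty$, where $f_r(z,w)=f(rz,rw)$ and $\mathbb{T}^2=\{|z|=|w|=1\}$ carries normalized Lebesgue measure. *)

(* Defs.v *)
From HB Require Import structures.
From mathcomp Require Import all_boot all_order all_algebra.
From mathcomp Require Import all_classical all_reals all_analysis.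
From mathcomp Require Import complex.
Set Implicit Arguments. Unset Strict Implicit. Unset Printing Implicit Defensive.
Import Order.TTheory GRing.Theory Num.Theory.
Import numFieldNormedType.Exports.
Local Open Scope ring_scope.
Local Open Scope classical_set_scope.
Local Open Scope complex_scope.

(* C = R[i] viewed as a normed module over itself (its usual metric topology
   given by the complex modulus), so that [derive1]/[derivable] are genuine
   complex derivatives. *)
Section complex_normed.
Variable R : rcfType.
HB.instance Definition _ := GRing.ComAlgebra.copy R[i] R[i]^o.
HB.instance Definition _ := Vector.copy R[i] R[i]^o.
HB.instance Definition _ := NormedModule.copy R[i] R[i]^o.
End complex_normed.

Definition cmod (R : rcfType) (x : R[i]) : R := complex.Re `|x|.

Definition bidisk (R : rcfType) (z w : R[i]) : Prop := `|z| < 1 /\ `|w| < 1.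

Definition eval2 (R : rcfType) (P : {poly {poly R[i]}}) (z w : R[i]) : R[i] :=
  (P.[z%:P]).[w].

(* f is a rational function on D^2 : f = P/Q on D^2 with Q zero-free on D^2
   (this is exactly "rational and analytic on D^2") *)
Definition rational_on_bidisk (R : rcfType) (f : R[i] -> R[i] -> R[i]) : Prop :=
  exists P Q : {poly {poly R[i]}}, forall z w, bidisk z w ->
    eval2 Q z w != 0 /\ f z w = eval2 P z w / eval2 Q z w.

Definition bounded_on_bidisk (R : rcfType) (f : R[i] -> R[i] -> R[i]) : Prop :=
  exists M : R, forall z w, bidisk z w -> cmod (f z w) <= M.

(* analytic on D^2: continuous and complex-differentiable in each variable
   separately (Osgood's definition of holomorphy in several variables) *)
Definition analytic_on_bidisk (R : rcfType) (g : R[i] -> R[i] -> R[i]) : Prop :=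
  forall z w, bidisk z w ->
    {for (z, w), continuous (fun p : R[i] * R[i] => g p.1 p.2)} /\
    derivable (fun u => g u w) z 1 /\ derivable (fun v => g z v) w 1.

Definition partial_z (R : rcfType) (f : R[i] -> R[i] -> R[i]) (z w : R[i]) : R[i] :=
  derive1 (fun u => f u w) z.
Definition partial_w (R : rcfType) (f : R[i] -> R[i] -> R[i]) (z w : R[i]) : R[i] :=
  derive1 (fun v => f z v) w.

Definition expi (R : realType) (s : R) : R[i] := cos s +i* sin s.

(* || g_r ||_{L^1(T^2)} w.r.t. normalized Lebesgue measure on T^2,
   T^2 parametrized by (s,t) in [0,2pi]^2 *)
Definition square2pi (R : realType) : set (R * R) :=
  `[0, 2 * pi] `*` `[0, 2 * pi].

Definition torus_L1_norm (R : realType) (g : R[i] -> R[i] -> R[i]) (r : R) : \bar R :=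
  ((4 * pi ^+ 2)^-1)%:E *
  (\int[(@lebesgue_measure R \x @lebesgue_measure R)%E]_(x in @square2pi R)
     (cmod (g (r%:C * expi x.1) (r%:C * expi x.2)))%:E)%E.

Definition H1_bidisk (R : realType) (g : R[i] -> R[i] -> R[i]) : Prop :=
  analytic_on_bidisk g /\
  exists M : R, forall r : R, 0 < r < 1 -> (torus_L1_norm g r <= M%:E)%E.

(* Main.v *)
Require Import Defs.
From HB Require Import structures.
From mathcomp Require Import all_boot all_order all_algebra.
From mathcomp Require Import all_classical all_reals all_analysis.
From mathcomp Require Import measurable_realfun complex polyXY ring lra zify.
Import Order.TTheory GRing.Theory Num.Theory.
Import numFieldNormedType.Exports.
Set Implicit Arguments. Unset Strict Implicit. Unset Printing Implicit Defensive.
Local Open Scope ring_scope.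
Local Open Scope classical_set_scope.
Local Open Scope complex_scope.

(** For fixed [w] the function [s |-> f (r e^{is}, w)] has real and imaginary
    parts that are rational in [e^{is}] of a degree bounded independently of [r]
    and [w].  The derivative of such a function, unless it vanishes identically,
    has at most as many zeros on the circle as some polynomial of bounded degree
    has roots, so the function is piecewise monotone with a bounded number of
    pieces, and its total variation is at most a constant times [sup |f|].  This
    bounds [r * \int |f_z (r e^{is}, w)| ds] uniformly; Tonelli's theorem
    concludes for [r > 1/2], and for [r <= 1/2] the integrand is bounded by
    compactness.  The other partial derivative follows by exchanging the
    variables. *)

(** * Total variation of a bounded function whose derivative has few zeros *)

Section variation.
Context {R : realType}.
Local Notation mu := (@lebesgue_measure R).

Lemma IVT_sign_change (g : R -> R) (x y : R) :
  continuous g -> x < y -> g x * g y < 0 -> exists2 c, x < c < y & g c = 0.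
Proof.
move=> cg xy gxy.
have [||c] := @IVT R g x y 0 (ltW xy).
- exact: continuous_subspaceT.
- by rewrite /Num.min /Num.max; case: ltP => h; nra.
rewrite in_itv/= => /andP[xc cy] gc0; exists c => //.
rewrite !lt_neqAle xc cy !andbT; apply/andP; split; apply/eqP => cE.
- by move: gxy; rewrite cE gc0 mul0r ltxx.
- by move: gxy; rewrite -cE gc0 mulr0 ltxx.
Qed.

(** Values of opposite sign at two points of the closed interval would force a zero strictly between
    them, hence in the open interval. The endpoints may themselves be zeros. *)
Lemma constant_sign (g : R -> R) (a b : R) :
  continuous g -> (forall x, a < x < b -> g x <> 0) ->
  (forall x, a <= x <= b -> 0 <= g x) \/ (forall x, a <= x <= b -> g x <= 0).
Proof.
move=> cg nz.
have key x y : a <= x -> y <= b -> x < y -> 0 <= g x * g y.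
  move=> ax yb xy; rewrite leNgt; apply/negP => /(IVT_sign_change cg xy)[c].
  by move=> /andP[xc cy]; apply: nz; rewrite (le_lt_trans ax xc) (lt_le_trans cy).
have [|/existsNP[x /not_implyP[/andP[ax xb] /negP]]] :=
  pselect (forall x, a <= x <= b -> 0 <= g x); first by left.
rewrite -ltNge => gx; right => y /andP[ay yb].
have [xy|yx|<-] := ltgtP x y; last exact: ltW.
- by have := key _ _ ax yb xy; nra.
- by have := key _ _ ay xb yx; nra.
Qed.

Lemma continuous_is_derive (u du : R -> R) :
  (forall x, is_derive x (1 : R) u (du x)) -> continuous u.
Proof.
move=> u_du x; apply/differentiable_continuous/derivable1_diffP.
by case: (u_du x).
Qed.

Lemma integral_is_derive (u du : R -> R) (a b : R) : a < b ->
  (forall x, is_derive x (1 : R) u (du x)) -> continuous du ->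
  (\int[mu]_(x in `[a, b]) (du x)%:E = (u b - u a)%:E)%E.
Proof.
move=> ab u_du du_cont.
have u_cont := continuous_is_derive u_du.
rewrite (@continuous_FTC2 _ du u)//.
- exact: continuous_subspaceT.
- split.
  + by move=> x _; case: (u_du x).
  + by apply: cvg_at_right_filter; exact: u_cont.
  + by apply: cvg_at_left_filter; exact: u_cont.
- by move=> x _; rewrite derive1E; case: (u_du x).
Qed.

Variables (u du : R -> R) (M : R).
Hypothesis u_du : forall x, is_derive x (1 : R) u (du x).
Hypothesis du_cont : continuous du.
Hypothesis u_le : forall x, `|u x| <= M.

(** Since [du] keeps its sign, [|du|] is [du] or [- du], and its integral is the increment of [u] up
    to sign, which is at most [2 * M]. *)
Lemma monotone_variation (a b : R) : a <= b ->
  (forall x, a < x < b -> du x <> 0) ->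
  (\int[mu]_(x in `[a, b]) `|du x|%:E <= (2 * M)%:E)%E.
Proof.
rewrite le_eqVlt => /predU1P[<- _|ab nz].
  rewrite set_itv1 integral_set1 lee_fin.
  by have := u_le a; have := normr_ge0 (u a); lra.
have := u_le a; have := u_le b; rewrite !ler_norml => /andP[? ?] /andP[? ?].
have [dup|dun] := constant_sign du_cont nz.
  rewrite (@eq_integral _ _ _ mu _ (EFin \o du)); last first.
    by move=> x; rewrite inE/= in_itv/= => /dup /ger0_norm ->.
  by rewrite (integral_is_derive ab u_du)// lee_fin; lra.
rewrite (@eq_integral _ _ _ mu _ (EFin \o (- du))); last first.
  by move=> x; rewrite inE/= in_itv/= => /dun /ler0_norm ->.
rewrite (@integral_is_derive (- u))// ?lee_fin; first by rewrite /= !fctE; lra.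
by move=> x; apply: continuousN; exact: du_cont.
Qed.

(** Cutting the interval at the zeros of [du] leaves at most [(size zs).+1] pieces on which [u] is
    monotone. The list [zs] only has to contain the interior zeros. *)
Lemma variation_le (zs : seq R) (a b : R) : a <= b ->
  (forall x, a < x < b -> du x = 0 -> x \in zs) ->
  (\int[mu]_(x in `[a, b]) `|du x|%:E <= ((size zs).+1%:R * (2 * M))%:E)%E.
Proof.
move=> ab zsP.
have M0 : 0 <= M := le_trans (normr_ge0 _) (u_le a).
have mdu (D : set R) : measurable D -> measurable_fun D (fun x => `|du x|%:E).
  move=> mD; apply/measurable_EFinP; apply: measurableT_comp => //.
  by apply: measurable_funTS; exact: continuous_measurable_fun.
pose cnt a b := count (fun x => a < x < b) zs.
(* Induction on a bound for the number of entries of [zs] inside the interval, for all intervals at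
   once, so that it applies to both halves after a cut. *)
suff main n : forall a b, a <= b -> (cnt a b <= n)%N ->
    (forall x, a < x < b -> du x = 0 -> x \in zs) ->
    (\int[mu]_(x in `[a, b]) `|du x|%:E <= ((cnt a b).+1%:R * (2 * M))%:E)%E.
  apply: (le_trans (main _ _ _ ab (leqnn _) zsP)); rewrite lee_fin ler_wpM2r//; first by lra.
  by rewrite ler_nat ltnS count_size.
elim: n => [|n IH] {ab zsP}a {}b ab cn zsP.
  apply: (le_trans (monotone_variation ab _)).
    move=> x xab /zsP -/(_ xab) xzs; move: cn; rewrite leqn0 => /eqP cn.
    have : has (fun x => a < x < b) zs by apply/hasP; exists x.
    by rewrite has_count -/(cnt a b) cn.
  by rewrite lee_fin ler_peMl ?ler1n//; lra.
have [nz|/existsNP[c /not_implyP[cab /contrapT duc]]] :=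
    pselect (forall x, a < x < b -> du x <> 0).
  apply: (le_trans (monotone_variation ab nz)).
  by rewrite lee_fin ler_peMl ?ler1n//; lra.
have /andP[ac cb] := cab.
have czs := zsP _ cab duc.
(* The cut point [c] belongs to [zs] and is interior to neither half. This strict loss drives the
   induction and also absorbs the extra [+ 1] when the two bounds are added. *)
have cnt_split : (cnt a c + cnt c b < cnt a b)%N.
  have c_mem : (0 < count_mem c zs)%N by rewrite -has_count has_pred1.
  suff : (cnt a c + cnt c b + count_mem c zs <= cnt a b)%N by lia.
  rewrite /cnt; elim: (zs) => //= x s.
  have [xc|cx|->] := ltgtP x c; rewrite ?cab ?andbF ?andbT/=.
  - by rewrite (lt_trans xc cb); lia.
  - by rewrite (lt_trans ac cx); lia.
  - by lia.
rewrite (@itv_bndbnd_setU _ _ _ (BLeft c)) ?bnd_simp ?(ltW ac) ?(ltW cb)//.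
rewrite ge0_integral_setU//=; last 2 first.
- by apply: mdu; exact: measurableU.
- by apply: lt_disjoint => x y; rewrite !in_itv/= => /andP[_ xc] /andP[/(lt_le_trans xc)].
rewrite integral_itv_bndo_bndc; last exact: mdu.
have := IH a c (ltW ac) _ _; have := IH c b (ltW cb) _ _.
move=> /(_ ltac:(lia)) IHcb /(_ ltac:(lia)) IHac.
apply: (le_trans (leeD (IHac _) (IHcb _))).
- by move=> x /andP[ax xc]; apply: zsP; rewrite ax (lt_trans xc).
- by move=> x /andP[cx xb]; apply: zsP; rewrite xb (lt_trans ac).
- rewrite -EFinD lee_fin -mulrDl ler_wpM2r//; first by lra.
  by rewrite -natrD ler_nat; lia.
Qed.

End variation.

(** * Complex derivatives of rational functions *)

Section horner_derive.
Context {K : numFieldType}.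

Lemma is_derive_horner (p : {poly K}) (z : K) :
  is_derive z (1 : K) (horner p) p^`().[z].
Proof.
elim/poly_ind: p => [|p r ih].
  rewrite (_ : horner 0 = cst 0) ?deriv0 ?horner0; last first.
    by apply/funext => y; rewrite horner0.
  exact: is_derive_cst.
rewrite (_ : horner _ = (horner p) * id + cst r); last first.
  by apply/funext => y; rewrite !hornerE.
apply: is_derive_eq.
rewrite !poly.derivE !hornerE /GRing.scale/=; ring.
Qed.

Lemma is_derive_horner_frac (p q : {poly K}) (z : K) : q.[z] != 0 ->
  is_derive z (1 : K) (fun u => p.[u] / q.[u])
    ((p^`() * q - p * q^`()).[z] / (q ^+ 2).[z]).
Proof.
move=> qz.
have dp := is_derive_horner p z; have dq := is_derive_horner q z.
have [dq1 dq2] := dq.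
have dqV : is_derive z (1 : K) (fun u => q.[u]^-1) (- q.[z] ^- 2 *: q^`().[z]).
  apply: DeriveDef; first exact: derivableV.
  by rewrite deriveV// dq2.
rewrite (_ : (fun u => _) = (horner p) * (fun u => q.[u]^-1)); last first.
  by apply/funext.
apply: is_derive_eq.
rewrite !hornerE /GRing.scale/=.
by field.
Qed.

End horner_derive.

(** * Zeros of real parts of rational functions on a circle *)

(** A duplicate-free list of maximal length misses no element, since a missing one could be
    prepended. This turns a bound on the number of roots into an actual list of zeros. *)
Lemma bounded_uniq_exhaust (T : eqType) (P : T -> Prop) (K : nat) :
  (forall s : seq T, uniq s -> {in s, forall x, P x} -> (size s <= K)%N) ->
  exists2 s : seq T, (size s <= K)%N & forall x, P x -> x \in s.
Proof.
move=> bnd.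
pose Q n := `[< exists s : seq T, [/\ uniq s, {in s, forall x, P x} & size s = n] >].
have Q0 : exists n, Q n by exists 0%N; apply/asboolP; exists [::].
have QK n : Q n -> (n <= K)%N.
  by move=> /asboolP[s [us sP <-]]; exact: bnd.
case: (ex_maxnP Q0 QK) => n /asboolP[s [us sP sn]] nmax.
exists s => [|x Px]; first exact: bnd.
apply: contraT => xs; suff /nmax : Q n.+1 by rewrite ltnn.
apply/asboolP; exists (x :: s); split; rewrite /= ?xs ?sn//.
by move=> y; rewrite inE => /predU1P[->|/sP].
Qed.

Section circle.
Context {R : realType}.
Local Notation C := R[i].
Local Notation Re := (@complex.Re R).
Local Notation Im := (@complex.Im R).
Implicit Types (s t r : R) (z : C) (p q N D : {poly C}).

Lemma cmodE z : cmod z = Num.sqrt (Re z ^+ 2 + Im z ^+ 2).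
Proof. by rewrite /cmod normc_def. Qed.

Lemma norm_cmod z : `|z| = (cmod z)%:C.
Proof. by rewrite cmodE normc_def. Qed.

Lemma cmodM z1 z2 : cmod (z1 * z2) = cmod z1 * cmod z2.
Proof. by apply: (@complexI R); rewrite rmorphM/= -!norm_cmod normrM. Qed.

Lemma cmodV z : cmod z^-1 = (cmod z)^-1.
Proof. by apply: (@complexI R); rewrite fmorphV/= -!norm_cmod normfV. Qed.

Lemma cmod_ge0 z : 0 <= cmod z.
Proof. by rewrite cmodE sqrtr_ge0. Qed.

Lemma cmod_gt0 z : (0 < cmod z) = (z != 0).
Proof. by rewrite -ltcR -norm_cmod normr_gt0. Qed.

Lemma Re_le_cmod z : `|Re z| <= cmod z.
Proof. by rewrite -lecR -norm_cmod normc_ge_Re. Qed.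

Lemma Im_le_cmod z : `|Im z| <= cmod z.
Proof. by rewrite cmodE -sqrtr_sqr ler_sqrt ?addr_ge0 ?sqr_ge0// lerDr sqr_ge0. Qed.

Lemma cmod_le_ReIm z : cmod z <= `|Re z| + `|Im z|.
Proof.
rewrite cmodE -[leRHS]ger0_norm ?addr_ge0// -sqrtr_sqr ler_sqrt ?sqr_ge0//.
rewrite -(real_normK (num_real (Re z))) -(real_normK (num_real (Im z))).
have := normr_ge0 (Re z); have := normr_ge0 (Im z); nra.
Qed.

Lemma cmod_expi s : cmod (expi s) = 1.
Proof. by rewrite cmodE /= cos2Dsin2 sqrtr1. Qed.

Lemma cmod_circle r s : 0 <= r -> cmod (r%:C * expi s) = r.
Proof. by move=> r0; rewrite cmodM cmod_expi mulr1 cmodE /= expr0n/= addr0 sqrtr_sqr ger0_norm. Qed.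

Lemma norm_circle_lt1 r s : 0 <= r -> r < 1 -> `|r%:C * expi s| < 1.
Proof. by move=> r0 r1; rewrite norm_cmod cmod_circle// ltcR. Qed.

(** Equality gives [cos (s - t) = 1], so the sine of the half-difference vanishes; but for [t < s]
    the half-difference lies strictly between [0] and [pi]. *)
Lemma expi_inj s t : 0 < s < 2 * pi -> 0 < t < 2 * pi -> expi s = expi t -> s = t.
Proof.
wlog st : s t / t <= s.
  by move=> H hs ht e; have [/H|/ltW/H] := leP t s; [exact|move=> h; apply/esym/h].
move=> hs ht [ec es]; apply/eqP; rewrite eq_le st andbT leNgt; apply/negP => ts.
have : cos (s - t) = 1.
  by rewrite cosB ec es -!expr2 cos2Dsin2.
rewrite (_ : s - t = ((s - t) / 2) *+ 2); last by rewrite -mulr_natr; field.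
rewrite cos_mulr2n => h.
have : 0 < sin ((s - t) / 2) by apply: sin_gt0_pi; lra.
have := cos2Dsin2 ((s - t) / 2).
move: (cos _) (sin _) h => c d h1 h2 h3; nra.
Qed.

(* [recip m r p] evaluates at a point [z] of the circle [`|z| = r] to
   [z ^+ m * (p.[z])^*], because there [z^* = r ^+ 2 / z]. *)
Definition recip (m : nat) r p : {poly C} :=
  \sum_(j < m.+1) ((p`_j)^* * r%:C ^+ (2 * j)) *: 'X^(m - j).

Lemma size_recip m r p : (size (recip m r p) <= m.+1)%N.
Proof.
apply: (leq_trans (size_sum _ _ _)); apply/bigmax_leqP => j _.
apply: (leq_trans (size_scale_leq _ _)); rewrite size_polyXn ltnS; exact: leq_subr.
Qed.

Lemma horner_recip m r p z : (size p <= m.+1)%N -> z * z^* = (r%:C) ^+ 2 ->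
  (recip m r p).[z] = z ^+ m * (p.[z])^*.
Proof.
move=> sp zz; rewrite /recip horner_sum (horner_coef_wide z sp).
rewrite rmorph_sum/= mulr_sumr; apply: eq_bigr => j _.
rewrite hornerZ hornerXn rmorphM/= rmorphXn/= exprM -zz exprMn.
have jm : (j <= m)%N by rewrite -ltnS.
rewrite (_ : z ^+ m = z ^+ (m - j) * z ^+ j); last by rewrite -exprD subnK.
by ring.
Qed.

(** Twice the real part is [a / b] plus its conjugate; clearing denominators leaves an expression
    that [recip] makes polynomial on a circle. *)
Lemma Re_frac_eq0 (a b : C) : b != 0 -> (Re (a / b) == 0) = (a * b^* + a^* * b == 0).
Proof.
move=> b0; have cb0 : b^* != 0 by rewrite conjc_eq0.
rewrite -(inj_eq (@complexI R)) rmorph0 ReJ_add mulf_eq0 invr_eq0 pnatr_eq0 orbF.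
rewrite rmorphM/= fmorphV.
rewrite (_ : a / b + a^* / b^* = (a * b^* + a^* * b) / (b * b^*)); last by field; rewrite b0 cb0.
by rewrite mulf_eq0 invr_eq0 mulf_eq0 (negbTE b0) (negbTE cb0) !orbF.
Qed.

(** On the circle, the zeros of the real part are the roots of one polynomial [G] of degree at most
    [2 * n]: either [G] is zero, or it has at most [2 * n] roots. *)
Lemma Re_frac_zeros (n : nat) r N D : 0 < r ->
  (size N <= n.+1)%N -> (size D <= n.+1)%N ->
  (forall s, D.[r%:C * expi s] != 0) ->
  (forall s, Re (N.[r%:C * expi s] / D.[r%:C * expi s]) = 0) \/
  exists2 zs : seq R, (size zs <= 2 * n)%N & forall s, 0 < s < 2 * pi ->
    Re (N.[r%:C * expi s] / D.[r%:C * expi s]) = 0 -> s \in zs.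
Proof.
move=> r0 sN sD Dn0; have rC0 : r%:C != 0 by rewrite -(rmorph0 (real_complex R)) (inj_eq (@complexI R)) gt_eqF.
pose z s := r%:C * expi s.
have zz s : z s * (z s)^* = r%:C ^+ 2.
  by rewrite -sqr_normc norm_cmod cmod_circle// ltW.
have z0 s : z s != 0 by rewrite -cmod_gt0 cmod_circle// ltW.
(* At a point [z] of the circle this is [z ^+ n] times the numerator from [Re_frac_eq0], and [z] is
   nonzero. *)
pose G := N * recip n r D + recip n r N * D.
have GE s : G.[z s] = z s ^+ n * (N.[z s] * (D.[z s])^* + (N.[z s])^* * D.[z s]).
  by rewrite /G !hornerE !horner_recip//; ring.
have G0 s : (Re (N.[z s] / D.[z s]) == 0) = root G (z s).
  rewrite Re_frac_eq0; last exact: Dn0.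
  by rewrite /root GE mulf_eq0 expf_eq0 (negbTE (z0 s)) andbF.
have [GZ|Gn0] := eqVneq G 0.
  by left => s; apply/eqP; rewrite G0 GZ root0.
right.
have sG : (size G <= (2 * n).+1)%N.
  apply: (leq_trans (size_polyD _ _)); rewrite geq_max.
  apply/andP; split; apply: (leq_trans (size_polyMleq _ _)).
  - by have := size_recip n r D; lia.
  - by have := size_recip n r N; lia.
have [|zs szs zsP] := @bounded_uniq_exhaust R
    (fun s => 0 < s < 2 * pi /\ Re (N.[z s] / D.[z s]) = 0) (2 * n); last first.
  by exists zs => // s hs h0; apply: zsP.
(* Distinct angles in the open interval give distinct points of the circle, hence distinct roots of
   [G]. *)
move=> zs uzs zsP; rewrite -ltnS -(size_map z); apply: leq_trans sG.
apply: max_poly_roots => //.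
  by apply/allP => _ /mapP[s /zsP[_ /eqP +] ->]; rewrite G0.
rewrite map_inj_in_uniq// => s t /zsP[hs _] /zsP[ht _] /(mulfI rC0).
exact: expi_inj.
Qed.

End circle.

(** * Rational functions along a circle *)

Section circle_derivative.
Context {R : realType}.
Local Notation C := R[i].
Local Notation Re := (@complex.Re R).
Local Notation Im := (@complex.Im R).
Implicit Types (s r : R) (h g : R -> C) (p q N D : {poly C}).

Lemma complex_ReD (a b : C) : Re (a + b) = Re a + Re b.
Proof. by case: a b => [? ?] [? ?]. Qed.

Lemma complex_ImD (a b : C) : Im (a + b) = Im a + Im b.
Proof. by case: a b => [? ?] [? ?]. Qed.

Lemma complex_ReM (a b : C) : Re (a * b) = Re a * Re b - Im a * Im b.
Proof. by case: a b => [? ?] [? ?]. Qed.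

Lemma complex_ImM (a b : C) : Im (a * b) = Re a * Im b + Im a * Re b.
Proof. by case: a b => [? ?] [? ?] /=; rewrite addrC. Qed.

(** Derivative of a complex-valued function of a real variable, taken by components so that the real
    variation bound applies to each of them. *)
Definition is_cderive h s (l : C) :=
  is_derive s (1 : R) (fun t => Re (h t)) (Re l) /\
  is_derive s (1 : R) (fun t => Im (h t)) (Im l).

Lemma is_cderive_cst (c : C) s : is_cderive (fun=> c) s 0.
Proof. by split; exact: is_derive_cst. Qed.

Lemma is_cderiveD h g s (a b : C) : is_cderive h s a -> is_cderive g s b ->
  is_cderive (fun t => h t + g t) s (a + b).
Proof.
move=> [h1 h2] [g1 g2]; split; rewrite ?complex_ReD ?complex_ImD.
- rewrite (_ : (fun t => _) = (fun t => Re (h t)) + (fun t => Re (g t))).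
    exact: is_deriveD.
  by apply/funext => t; rewrite complex_ReD.
- rewrite (_ : (fun t => _) = (fun t => Im (h t)) + (fun t => Im (g t))).
    exact: is_deriveD.
  by apply/funext => t; rewrite complex_ImD.
Qed.

Lemma is_cderiveM h g s (a b : C) : is_cderive h s a -> is_cderive g s b ->
  is_cderive (fun t => h t * g t) s (a * g s + h s * b).
Proof.
move=> [h1 h2] [g1 g2]; split.
- rewrite (_ : (fun t => _) = (fun t => Re (h t)) * (fun t => Re (g t))
     - (fun t => Im (h t)) * (fun t => Im (g t))); last first.
    by apply/funext => t; rewrite complex_ReM.
  apply: is_derive_eq (is_deriveB (is_deriveM h1 g1) (is_deriveM h2 g2)) _.
  rewrite complex_ReD !complex_ReM /GRing.scale/=; ring.
- rewrite (_ : (fun t => _) = (fun t => Re (h t)) * (fun t => Im (g t))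
     + (fun t => Im (h t)) * (fun t => Re (g t))); last first.
    by apply/funext => t; rewrite complex_ImM.
  apply: is_derive_eq (is_deriveD (is_deriveM h1 g2) (is_deriveM h2 g1)) _.
  rewrite complex_ImD !complex_ImM /GRing.scale/=; ring.
Qed.

(** The components of the inverse are [Re h / n2] and [- Im h / n2] with [n2] the squared modulus,
    so real calculus applies. *)
Lemma is_cderiveV h s (a : C) : h s != 0 -> is_cderive h s a ->
  is_cderive (fun t => (h t)^-1) s (- a / h s ^+ 2).
Proof.
move=> hs0 [h1 h2].
have n0 : Re (h s) ^+ 2 + Im (h s) ^+ 2 != 0.
  by rewrite -(inj_eq (@complexI R)) rmorph0 add_Re2_Im2 expf_eq0/= normr_eq0.
pose n2 := (fun t => Re (h t)) ^+ 2 + (fun t => Im (h t)) ^+ 2.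
have dn2 : is_derive s (1 : R) n2 (2 * (Re (h s) * Re a + Im (h s) * Im a)).
  apply: is_derive_eq (is_deriveD (is_deriveX 2 h1) (is_deriveX 2 h2)) _.
  by rewrite /GRing.scale /= !expr1; ring.
have dV : is_derive s (1 : R) (fun t => (n2 t)^-1)
    (- (n2 s) ^- 2 *: (2 * (Re (h s) * Re a + Im (h s) * Im a))).
  exact: is_deriveV.
(* The squared modulus of a square is the square of the squared modulus; this shows that the
   denominator coming from [h s ^+ 2] is nonzero. *)
have sqr_norm_sqr (x y : R) :
    (x * x - y * y) ^+ 2 + (x * y + y * x) ^+ 2 = (x ^+ 2 + y ^+ 2) ^+ 2 by ring.
split.
- rewrite (_ : (fun t => _) = (fun t => Re (h t)) * (fun t => (n2 t)^-1)); last first.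
    by apply/funext => t; rewrite /n2 /= !fctE; case: (h t).
  apply: is_derive_eq; rewrite /GRing.scale/= /n2 !fctE.
  case: (h s) hs0 n0 => x y /= hs0 n0; case: a {h1 h2 dn2 dV} => a b /=.
  by field; rewrite n0 (sqr_norm_sqr x y) expf_neq0.
- rewrite (_ : (fun t => _) = - ((fun t => Im (h t)) * (fun t => (n2 t)^-1))); last first.
    by apply/funext => t; rewrite /n2 /= !fctE; case: (h t).
  apply: is_derive_eq; rewrite /GRing.scale/= /n2 !fctE.
  case: (h s) hs0 n0 => x y /= hs0 n0; case: a {h1 h2 dn2 dV} => a b /=.
  by field; rewrite n0 (sqr_norm_sqr x y) expf_neq0.
Qed.

Lemma is_cderive_circle r s : is_cderive (fun t => r%:C * expi t) s ('i%C * (r%:C * expi s)).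
Proof.
split.
- rewrite (_ : (fun t => _) = r *: (cos : R -> R)); last first.
    by apply/funext => t; rewrite complex_ReM /= mul0r subr0.
  by apply: is_derive_eq; rewrite /GRing.scale/=; ring.
- rewrite (_ : (fun t => _) = r *: (sin : R -> R)); last first.
    by apply/funext => t; rewrite complex_ImM /= mul0r addr0.
  by apply: is_derive_eq; rewrite /GRing.scale/=; ring.
Qed.

Lemma is_cderive_eq h s (a b : C) : is_cderive h s a -> a = b -> is_cderive h s b.
Proof. by move=> ? <-. Qed.

Lemma is_cderive_horner p h s (a : C) : is_cderive h s a ->
  is_cderive (fun t => p.[h t]) s (p^`().[h s] * a).
Proof.
move=> ha; elim/poly_ind: p => [|p c ih].
  rewrite (_ : (fun t => _) = fun=> 0); last by apply/funext => t; rewrite horner0.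
  by apply: is_cderive_eq (is_cderive_cst _ _) _; rewrite deriv0 horner0 mul0r.
rewrite (_ : (fun t => _) = fun t => p.[h t] * h t + c); last first.
  by apply/funext => t; rewrite !hornerE.
apply: is_cderive_eq (is_cderiveD (is_cderiveM ih ha) (is_cderive_cst _ _)) _.
by rewrite !poly.derivE !hornerE; ring.
Qed.

(** The factor after [a] is the complex derivative of [p / q], in the same form as in
    [is_derive_horner_frac]. *)
Lemma is_cderive_frac p q h s (a : C) : is_cderive h s a -> q.[h s] != 0 ->
  is_cderive (fun t => p.[h t] / q.[h t]) s
    (a * ((p^`() * q - p * q^`()).[h s] / (q ^+ 2).[h s])).
Proof.
move=> ha q0.
apply: is_cderive_eq (is_cderiveM (is_cderive_horner p ha)
  (is_cderiveV q0 (is_cderive_horner q ha))) _.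
by rewrite !hornerE /=; field.
Qed.

End circle_derivative.

(** * Continuity by real and imaginary parts *)

Section complex_continuity.
Context {R : realType} {T : topologicalType}.
Local Notation C := R[i].
Implicit Types (h g : T -> C) (x : T).

Definition ReIm_continuous_at x h :=
  {for x, continuous (fun t => complex.Re (h t))} /\
  {for x, continuous (fun t => complex.Im (h t))}.

Lemma continuous_cmod h x : ReIm_continuous_at x h ->
  {for x, continuous (fun t => cmod (h t))}.
Proof.
move=> [c1 c2].
rewrite (_ : (fun t => _) = Num.sqrt \o (fun t =>
    complex.Re (h t) * complex.Re (h t) + complex.Im (h t) * complex.Im (h t))).
  apply: continuous_comp; last exact: sqrt_continuous.
  by apply: cvgD; [exact: (cvgM c1 c1)|exact: (cvgM c2 c2)].
by apply/funext => t; rewrite cmodE !expr2.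
Qed.

Lemma ReIm_continuousD x h g : ReIm_continuous_at x h -> ReIm_continuous_at x g ->
  ReIm_continuous_at x (fun t => h t + g t).
Proof.
move=> [h1 h2] [g1 g2]; split.
- rewrite (_ : (fun t => _) = fun t => complex.Re (h t) + complex.Re (g t)); first exact: (cvgD h1 g1).
  by apply/funext => t; rewrite complex_ReD.
- rewrite (_ : (fun t => _) = fun t => complex.Im (h t) + complex.Im (g t)); first exact: (cvgD h2 g2).
  by apply/funext => t; rewrite complex_ImD.
Qed.

Lemma ReIm_continuousM x h g : ReIm_continuous_at x h -> ReIm_continuous_at x g ->
  ReIm_continuous_at x (fun t => h t * g t).
Proof.
move=> [h1 h2] [g1 g2]; split.
- rewrite (_ : (fun t => _) = fun t => complex.Re (h t) * complex.Re (g t) -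
    complex.Im (h t) * complex.Im (g t)); first exact: (cvgB (cvgM h1 g1) (cvgM h2 g2)).
  by apply/funext => t; rewrite complex_ReM.
- rewrite (_ : (fun t => _) = fun t => complex.Re (h t) * complex.Im (g t) +
    complex.Im (h t) * complex.Re (g t)); first exact: (cvgD (cvgM h1 g2) (cvgM h2 g1)).
  by apply/funext => t; rewrite complex_ImM.
Qed.

Lemma ReIm_continuous_cst x (c : C) : ReIm_continuous_at x (fun=> c).
Proof. by split; exact: cvg_cst. Qed.

End complex_continuity.

(** * Polynomial expressions in a class of functions closed under ring operations *)

Section eval2_closed.
Context {R : rcfType} {T : Type}.
Local Notation C := R[i].
Variable K : (T -> C) -> Prop.
Hypothesis K_cst : forall c, K (fun=> c).
Hypothesis KD : forall h g, K h -> K g -> K (fun t => h t + g t).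
Hypothesis KM : forall h g, K h -> K g -> K (fun t => h t * g t).

Lemma horner_closed (p : {poly C}) h : K h -> K (fun t => p.[h t]).
Proof.
move=> Kh; elim/poly_ind: p => [|p c ih].
  by rewrite (_ : (fun t => _) = fun=> 0)//; apply/funext => t; rewrite horner0.
rewrite (_ : (fun t => _) = fun t => p.[h t] * h t + c).
  by apply: KD => //; exact: KM.
by apply/funext => t; rewrite !hornerE.
Qed.

(** Serves with [K] as complex continuity at a point, continuity by components, and measurability by
    components. *)
Lemma eval2_closed (P : {poly {poly C}}) h g : K h -> K g ->
  K (fun t => eval2 P (h t) (g t)).
Proof.
move=> Kh Kg; elim/poly_ind: P => [|P p ih].
  rewrite (_ : (fun t => _) = fun=> 0)//; apply/funext => t.
  by rewrite /eval2 !horner0.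
rewrite (_ : (fun t => _) = fun t => eval2 P (h t) (g t) * h t + p.[g t]).
  by apply: KD; [exact: KM|exact: horner_closed].
by apply/funext => t; rewrite /eval2 !hornerE.
Qed.

End eval2_closed.

(** Differentiation lowers the degree by one, which leaves room for the factor ['X] in
    [circle_L1]. *)
Lemma size_frac_deriv_num (K : nzRingType) (n : nat) (p q : {poly K}) :
  (size p <= n.+1)%N -> (size q <= n.+1)%N ->
  (size (deriv p * q - p * deriv q)%R <= 2 * n)%N.
Proof.
move=> sp sq.
have sd (h : {poly K}) : (size (deriv h) <= (size h).-1)%N.
  have [->|/lt_size_deriv] := eqVneq h 0; last by lia.
  by rewrite deriv0 size_poly0.
apply: (leq_trans (size_polyD _ _)); rewrite size_polyN geq_max.
apply/andP; split; apply: (leq_trans (size_polyMleq _ _)).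
- by have := sd p; lia.
- by have := sd q; lia.
Qed.

(** * Uniform mean bounds for the derivative of a rational function on a circle *)

Section circle_variation.
Context {R : realType}.
Local Notation C := R[i].
Local Notation mu := (@lebesgue_measure R).
Local Notation Re := (@complex.Re R).
Local Notation Im := (@complex.Im R).
Implicit Types (s r M : R) (p q N D : {poly C}) (n : nat).

Lemma continuous_Re_circle_frac r p q : (forall s, q.[r%:C * expi s] != 0) ->
  continuous (fun s => Re (p.[r%:C * expi s] / q.[r%:C * expi s])).
Proof.
move=> q0; apply: continuous_is_derive => s.
by have [h _] := is_cderive_frac p (is_cderive_circle r s) (q0 s); exact: h.
Qed.

Lemma circle_variation n r M N D (u : R -> R) : 0 < r ->
  (size N <= n.+1)%N -> (size D <= n.+1)%N ->
  (forall s, D.[r%:C * expi s] != 0) ->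
  (forall s, is_derive s (1 : R) u (Re (N.[r%:C * expi s] / D.[r%:C * expi s]))) ->
  (forall s, `|u s| <= M) ->
  (\int[mu]_(s in `[0%R, (2 * pi)%R])
     `|Re (N.[r%:C * expi s] / D.[r%:C * expi s])|%:E
   <= ((2 * n)%N.+1%:R * (2 * M))%:E)%E.
Proof.
move=> r0 sN sD D0 du uM.
have M0 : 0 <= M := le_trans (normr_ge0 _) (uM 0).
have [Z|[zs szs zsP]] := Re_frac_zeros r0 sN sD D0.
  rewrite integral0_eq ?lee_fin ?mulr_ge0// => s _.
  by rewrite Z normr0.
have pi0 : 0 <= 2 * pi :> R by rewrite mulr_ge0 ?pi_ge0.
have dc := continuous_Re_circle_frac (p := N) D0.
apply: (le_trans (variation_le du dc uM pi0 zsP)).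
by rewrite lee_fin ler_wpM2r ?mulr_ge0// ler_nat ltnS.
Qed.

(** With [z = r e^{is}], the derivative of [p / q] in [s] is [i z] times its complex derivative. Its
    real and imaginary parts are bounded separately by [circle_variation], and [|i z| = r] accounts
    for [r^-1]. *)
Lemma circle_L1 n r M p q : 0 < r ->
  (size p <= n.+1)%N -> (size q <= n.+1)%N ->
  (forall s, q.[r%:C * expi s] != 0) ->
  (forall s, cmod (p.[r%:C * expi s] / q.[r%:C * expi s]) <= M) ->
  (\int[mu]_(s in `[0%R, (2 * pi)%R])
     (cmod ((p^`() * q - p * q^`()).[r%:C * expi s] / (q ^+ 2).[r%:C * expi s]))%:E
   <= (r^-1 * ((4 * n)%N.+1%:R * (4 * M)))%:E)%E.
Proof.
move=> r0 sp sq q0 pqM.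
set W := p^`() * q - p * q^`().
have q20 s : (q ^+ 2).[r%:C * expi s] != 0 by rewrite horner_exp expf_neq0.
(* [circle_variation] speaks of real parts only: as [N1] is [i] times [N2], the imaginary part of
   the quotient with [N1] is the real part of the one with [N2]. *)
pose N1 := 'i%C *: ('X * W); pose N2 := 'X * W.
pose z s := r%:C * expi s.
have sW : (size W <= 2 * n)%N by exact: size_frac_deriv_num.
have sN2 : (size N2 <= (2 * n).+1)%N.
  by apply: (leq_trans (size_polyMleq _ _)); rewrite size_polyX; lia.
have sN1 : (size N1 <= (2 * n).+1)%N.
  exact: (leq_trans (size_scale_leq _ _)).
have sD : (size (q ^+ 2) <= (2 * n).+1)%N.
  by rewrite expr2; apply: (leq_trans (size_polyMleq _ _)); lia.
have E1 s : N1.[z s] / (q ^+ 2).[z s] = 'i%C * z s * (W.[z s] / (q ^+ 2).[z s]).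
  by rewrite /N1 hornerZ hornerM hornerX !mulrA.
have E2 s : Re (N2.[z s] / (q ^+ 2).[z s]) = Im (N1.[z s] / (q ^+ 2).[z s]).
  by rewrite /N1 /N2 hornerZ -mulrA -ImiRe mulrC.
have d1 s : is_derive s (1 : R) (fun t => Re (p.[z t] / q.[z t]))
    (Re (N1.[z s] / (q ^+ 2).[z s])).
  by rewrite E1; have [] := is_cderive_frac p (is_cderive_circle r s) (q0 s).
have d2 s : is_derive s (1 : R) (fun t => Im (p.[z t] / q.[z t]))
    (Re (N2.[z s] / (q ^+ 2).[z s])).
  by rewrite E2 E1; have [] := is_cderive_frac p (is_cderive_circle r s) (q0 s).
have v1 := circle_variation r0 sN1 sD q20 d1 (fun s => le_trans (Re_le_cmod _) (pqM s)).
have v2 := circle_variation r0 sN2 sD q20 d2 (fun s => le_trans (Im_le_cmod _) (pqM s)).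
have c1 := continuous_Re_circle_frac (p := N1) q20.
have c2 := continuous_Re_circle_frac (p := N2) q20.
have mN (g : R -> R) : continuous g ->
    measurable_fun `[0%R, (2 * pi)%R] (fun s => `|g s|%:E).
  move=> cg; apply/measurable_EFinP; apply: measurableT_comp => //.
  by apply: measurable_funTS; exact: continuous_measurable_fun.
have mS := emeasurable_funD (mN _ c1) (mN _ c2).
have c3 : continuous (fun s => cmod (N1.[z s] / (q ^+ 2).[z s])).
  move=> s; suff : ReIm_continuous_at s (fun t => N1.[z t] / (q ^+ 2).[z t]).
    by move=> /continuous_cmod.
  split; first exact: c1.
  rewrite (_ : (fun t => _) = fun t => Re (N2.[z t] / (q ^+ 2).[z t])); first exact: c2.
  by apply/funext => t; rewrite E2.
have cmodE' s : cmod (W.[z s] / (q ^+ 2).[z s]) =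
    r^-1 * cmod (N1.[z s] / (q ^+ 2).[z s]).
  rewrite E1 cmodM [cmod ('i%C * _)]cmodM cmod_circle ?(ltW r0)//.
  rewrite [cmod 'i%C]cmodE /= expr0n /= add0r expr1n sqrtr1 mul1r mulKf ?gt_eqF//.
under eq_integral do rewrite -/(z _) cmodE'.
apply: (@le_trans _ _ (\int[mu]_(s in `[0%R, (2 * pi)%R])
   (r^-1%:E * (`|Re (N1.[z s] / (q ^+ 2).[z s])|%:E + `|Re (N2.[z s] / (q ^+ 2).[z s])|%:E))))%E.
  apply: ge0_le_integral => //.
  - by move=> s _; rewrite lee_fin mulr_ge0 ?cmod_ge0// invr_ge0 ltW.
  - apply/measurable_EFinP; apply: measurable_funM; first exact: measurable_cst.
    by apply: measurable_funTS; exact: continuous_measurable_fun.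
  - exact: (emeasurable_funM (measurable_cst _) mS).
  - move=> s _; rewrite -EFinD -EFinM lee_fin ler_wpM2l ?invr_ge0 ?(ltW r0)//.
    by rewrite E2; exact: cmod_le_ReIm.
rewrite ge0_integralZl//; last 2 first.
- by move=> s _; rewrite adde_ge0.
- by rewrite lee_fin invr_ge0 ltW.
rewrite EFinM lee_wpmul2l ?lee_fin ?invr_ge0 ?(ltW r0)//.
rewrite ge0_integralD//; [|exact: (mN _ c1)|exact: (mN _ c2)].
apply: (le_trans (leeD v1 v2)).
(* Numerators and denominator have degree at most [2 * n], so each part contributes [(4 * n).+1]
   times [2 * M]. *)
rewrite -EFinD lee_fin (_ : (2 * (2 * n)).+1 = (4 * n).+1)%N; last by lia.
lra.
Qed.

End circle_variation.

(** * Rational functions on the bidisk *)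

Section near_rational.
Context {K : numFieldType}.

Lemma near_norm_lt1 (z : K) : `|z| < 1 -> \forall y \near z, `|y| < 1.
Proof.
move=> z1; apply/nbhs_ballP; exists (1 - `|z|) => /=; first by rewrite subr_gt0.
move=> y; rewrite /ball/= ltrBrDr => yz.
by rewrite (le_lt_trans _ yz)// -{1}(subrK z y) distrC (le_trans (ler_normD _ _)).
Qed.

(** Outside the disk [f] is arbitrary; the derivative only sees a neighbourhood of [z], where [f] is
    the quotient. *)
Lemma is_derive_near_frac (f : K -> K) (p q : {poly K}) (z : K) : `|z| < 1 ->
  (forall u, `|u| < 1 -> q.[u] != 0 /\ f u = p.[u] / q.[u]) ->
  is_derive z (1 : K) f ((p^`() * q - p * q^`()).[z] / (q ^+ 2).[z]).
Proof.
move=> z1 fE; have [qz _] := fE _ z1.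
apply: near_eq_is_derive (is_derive_horner_frac p qz).
by near=> u; apply/esym; apply: (fE u _).2; near: u; exact: near_norm_lt1.
Unshelve. all: by end_near. Qed.

Lemma continuous_at_cst {T : topologicalType} (x : T) (c : K) :
  {for x, continuous (fun=> c)}.
Proof. exact: cvg_cst. Qed.

Lemma continuous_atD {T : topologicalType} (x : T) (h g : T -> K) :
  {for x, continuous h} -> {for x, continuous g} ->
  {for x, continuous (fun t => h t + g t)}.
Proof. by move=> ch cg; exact: (cvgD ch cg). Qed.

Lemma continuous_atM {T : topologicalType} (x : T) (h g : T -> K) :
  {for x, continuous h} -> {for x, continuous g} ->
  {for x, continuous (fun t => h t * g t)}.
Proof. by move=> ch cg; exact: (cvgM ch cg). Qed.

Lemma continuous_at_near_div (A B : K * K -> K) (F : K * K -> K) (z w : K) :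
  `|z| < 1 -> `|w| < 1 ->
  (forall u v, `|u| < 1 -> `|v| < 1 -> B (u, v) != 0 /\ F (u, v) = A (u, v) / B (u, v)) ->
  {for (z, w), continuous A} -> {for (z, w), continuous B} ->
  {for (z, w), continuous F}.
Proof.
move=> z1 w1 FE cA cB; have [Bn0 Fzw] := FE _ _ z1 w1.
rewrite /prop_for /continuous_at Fzw.
apply: cvg_trans (cvgM cA (cvgV Bn0 cB)).
apply: near_eq_cvg; exists ([set u | `|u| < 1], [set v | `|v| < 1]) => /=.
  by split; exact: near_norm_lt1.
by move=> [u v] [/= u1 v1]; have [_ ->] := FE _ _ u1 v1.
Qed.

End near_rational.

Section rational_bidisk.
Context {R : realType}.
Local Notation C := R[i].
Implicit Types (f g : C -> C -> C) (P Q A B : {poly {poly C}}) (z w : C).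

Lemma eval2_swapXY P z w : eval2 (swapXY P) z w = eval2 P w z.
Proof. exact: horner2_swapXY. Qed.

(** The outer variable of [P] is the first one, so [w] is substituted into the coefficients. The
    size stays at most that of [P] for every [w], which makes the later bounds uniform. *)
Definition slice P w : {poly C} := map_poly (horner_eval w) P.

Lemma horner_slice P z w : (slice P w).[z] = eval2 P z w.
Proof. by rewrite /slice -horner_swapXY -[LHS]/(eval2 _ w z) eval2_swapXY. Qed.

Lemma size_slice P w : (size (slice P w) <= size P)%N.
Proof. exact: size_poly. Qed.

Lemma rational_swap f : rational_on_bidisk f -> rational_on_bidisk (fun z w => f w z).
Proof.
move=> [P [Q fE]]; exists (swapXY P), (swapXY Q) => z w [z1 w1].
by rewrite !eval2_swapXY; apply: fE.
Qed.

Lemma partial_z_slice f P Q :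
  (forall z w, bidisk z w -> eval2 Q z w != 0 /\ f z w = eval2 P z w / eval2 Q z w) ->
  forall z w, bidisk z w -> partial_z f z w =
    ((slice P w)^`() * slice Q w - slice P w * (slice Q w)^`()).[z] / (slice Q w ^+ 2).[z].
Proof.
move=> fE z w [z1 w1]; rewrite /partial_z derive1E.
have fE' u : `|u| < 1 -> (slice Q w).[u] != 0 /\
    f u w = (slice P w).[u] / (slice Q w).[u].
  by move=> u1; rewrite !horner_slice; apply: fE.
by have [_] := is_derive_near_frac z1 fE'.
Qed.

(** Quotient rule in the outer variable: formal differentiation commutes with evaluating the
    coefficients at [w], and [Q ^+ 2] is zero-free with [Q]. *)
Lemma rational_partial_z f : rational_on_bidisk f -> rational_on_bidisk (partial_z f).
Proof.
move=> [P [Q fE]]; exists (P^`() * Q - P * Q^`()), (Q ^+ 2) => z w zw.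
have [Q0 _] := fE _ _ zw.
have E2 : eval2 (Q ^+ 2) z w = eval2 Q z w ^+ 2 by rewrite /eval2 !horner_exp.
rewrite E2 expf_neq0//; split=> //.
have dslice S : (slice S w)^`().[z] = eval2 S^`() z w.
  by rewrite -horner_slice /slice deriv_map.
rewrite (partial_z_slice fE)// horner_exp horner_slice; congr (_ / _).
by rewrite hornerD hornerN !hornerM !dslice !horner_slice /eval2 !hornerE.
Qed.

Lemma rational_analytic g : rational_on_bidisk g -> analytic_on_bidisk g.
Proof.
move=> [A [B gE]] z w [z1 w1].
have c2 P : {for (z, w), continuous (fun x : C * C => eval2 P x.1 x.2)}.
  apply: (@eval2_closed R (C * C)%type (fun h => {for (z, w), continuous h})).
  - by move=> c; exact: continuous_at_cst.
  - by move=> h k; exact: continuous_atD.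
  - by move=> h k; exact: continuous_atM.
  - exact: cvg_fst.
  - exact: cvg_snd.
split; [|split].
- apply: (continuous_at_near_div z1 w1 _ (c2 A) (c2 B)).
  by move=> u v u1 v1; apply: gE.
- have gz u : `|u| < 1 -> (slice B w).[u] != 0 /\
      g u w = (slice A w).[u] / (slice B w).[u].
    by move=> u1; rewrite !horner_slice; apply: gE.
  by have [] := is_derive_near_frac z1 gz.
(* With the first variable fixed, [A.[z%:P]] and [B.[z%:P]] are already polynomials in the
   second. *)
- have gw v : `|v| < 1 -> (B.[z%:P]).[v] != 0 /\
      g z v = (A.[z%:P]).[v] / (B.[z%:P]).[v].
    by move=> v1; apply: (gE z v).
  by have [] := is_derive_near_frac w1 gw.
Qed.

End rational_bidisk.

(** * Integration over the torus *)

Section torus_bound.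
Context {R : realType}.
Local Notation C := R[i].
Local Notation mu := (@lebesgue_measure R).
Local Notation I := (`[0%R, (2 * pi)%R])%classic.
Implicit Types (f g : C -> C -> C) (r s t M c : R).

Let pi0 : 0 <= 2 * pi :> R.
Proof. by rewrite mulr_ge0 ?pi_ge0. Qed.

Lemma integral_cst_2pi c : (\int[mu]_(x in I) c%:E = (c * (2 * pi))%:E)%E.
Proof.
rewrite integral_cst//= lebesgue_measure_itv/= lte_fin.
have [_|h] := ltP 0 (2 * pi : R); first by rewrite oppr0 adde0.
by have -> : (2 * pi : R) = 0 by [apply/eqP; rewrite eq_le h pi0]; rewrite !mulr0 mule0.
Qed.

(** Tonelli with the first variable innermost: the inner integrals are at most [c], and the outer
    interval has length [2 * pi]. *)
Lemma integral_square_le2 (F : R * R -> R) c : (forall x, 0 <= F x) ->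
  measurable_fun setT F ->
  (forall t, 0 <= t <= 2 * pi -> (\int[mu]_(s in I) (F (s, t))%:E <= c%:E)%E) ->
  (\int[(mu \x mu)%E]_(x in @square2pi R) (F x)%:E <= (c * (2 * pi))%:E)%E.
Proof.
move=> F0 mF Fc.
have c0 : 0 <= c.
  rewrite -lee_fin; apply: le_trans (Fc 0 _); last by rewrite lexx pi0.
  by apply: integral_ge0 => s _; rewrite lee_fin.
have mS : measurable (@square2pi R) by exact: measurableX.
pose G := (EFin \o F) \_ (@square2pi R).
have G0 x : (0 <= G x)%E.
  by rewrite /G patchE; case: ifPn => // _; rewrite lee_fin.
have mG : measurable_fun setT G.
  apply/(measurable_restrictT _ mS); apply: measurable_funTS.
  exact/measurable_EFinP.
have -> : (\int[(mu \x mu)%E]_(x in @square2pi R) (F x)%:E = \int[mu]_t fubini_G mu G t)%E.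
  by rewrite integral_mkcond; exact: (@fubini_tonelli2 _ _ _ _ R mu mu G mG G0).
(* [G] is [F] extended by zero outside the square, so its inner integral vanishes for [t] outside
   [I]. *)
have GI : fubini_G mu G = (fubini_G mu G) \_ I.
  apply/funext => t; rewrite [RHS]patchE; case: ifPn => // tI.
  rewrite /fubini_G integral0_eq// => s _; rewrite /G patchE /square2pi in_setX/=.
  by rewrite (negbTE tI) andbF.
rewrite GI -integral_mkcond -integral_cst_2pi.
apply: ge0_le_integral => //.
- by move=> t _; apply: integral_ge0.
- by apply: measurable_funTS; exact: measurable_fun_fubini_tonelli_G.
- move=> t tI; rewrite /fubini_G.
  rewrite (_ : (fun s => G (s, t)) = (fun s => (F (s, t))%:E) \_ I).
    by rewrite -integral_mkcond; apply: Fc; move: tI; rewrite /= in_itv.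
  apply/funext => s; rewrite /G !patchE /square2pi in_setX/=.
  by rewrite (mem_set tI) andbT.
Qed.

(** Reduces to [integral_square_le2] by exchanging coordinates: Tonelli in the two orders shows that
    the integral over the square is invariant under the swap. *)
Lemma integral_square_le1 (F : R * R -> R) c : (forall x, 0 <= F x) ->
  measurable_fun setT F ->
  (forall s, 0 <= s <= 2 * pi -> (\int[mu]_(t in I) (F (s, t))%:E <= c%:E)%E) ->
  (\int[(mu \x mu)%E]_(x in @square2pi R) (F x)%:E <= (c * (2 * pi))%:E)%E.
Proof.
move=> F0 mF Fc.
have mS : measurable (@square2pi R) by exact: measurableX.
have mEF : measurable_fun (@square2pi R) (EFin \o F).
  by apply: measurable_funTS; exact/measurable_EFinP.
pose G := (EFin \o F) \_ (@square2pi R).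
pose G' := (EFin \o (F \o unstable.swap)) \_ (@square2pi R).
have mG : measurable_fun setT G by exact/(measurable_restrictT _ mS).
have mFs : measurable_fun setT (F \o unstable.swap).
  by apply: measurableT_comp => //; exact: measurable_swap.
have mG' : measurable_fun setT G'.
  apply/(measurable_restrictT _ mS); apply: measurable_funTS.
  exact/measurable_EFinP.
have G0 x : (0 <= G x)%E by rewrite /G patchE; case: ifPn => // _; rewrite lee_fin.
have G'0 x : (0 <= G' x)%E by rewrite /G' patchE; case: ifPn => // _; rewrite lee_fin /=.
have GG' : fubini_F mu G = fubini_G mu G'.
  apply/funext => x; apply: eq_integral => y _.
  by rewrite /G /G' !patchE /square2pi !in_setX/= andbC.
have -> : (\int[(mu \x mu)%E]_(x in @square2pi R) (F x)%:E =
    \int[(mu \x mu)%E]_(x in @square2pi R) (F (unstable.swap x))%:E)%E.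
  rewrite integral_mkcond.
  apply: (eq_trans (@fubini_tonelli1 _ _ _ _ R mu mu G mG G0)).
  apply: (@eq_trans _ _ (\int[mu]_x fubini_G mu G' x)%E).
    by apply: eq_integral => x _; exact: (congr1 (@^~ x) GG').
  rewrite [RHS]integral_mkcond; apply/esym.
  exact: (@fubini_tonelli2 _ _ _ _ R mu mu G' mG' G'0).
exact: (@integral_square_le2 (F \o unstable.swap) c (fun x => F0 _) mFs Fc).
Qed.

End torus_bound.

(** * Measurability on tori and boundedness for small radii *)

Section torus_regularity.
Context {R : realType}.
Local Notation C := R[i].
Implicit Types (g : C -> C -> C) (P : {poly {poly C}}) (r s t M c : R).

Lemma circle_bidisk r s t : 0 <= r -> r < 1 -> bidisk (r%:C * expi s) (r%:C * expi t).
Proof. by move=> r0 r1; split; exact: norm_circle_lt1. Qed.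

(** The modulus is [|A| / |B|]. Both moduli are measurable, and [|B|] stays in the open half-line
    where inversion is continuous. *)
Lemma measurable_cmod_torus g r : rational_on_bidisk g -> 0 <= r -> r < 1 ->
  measurable_fun setT (fun x : R * R => cmod (g (r%:C * expi x.1) (r%:C * expi x.2))).
Proof.
move=> [A [B gE]] r0 r1.
pose mC (h : R * R -> C) := measurable_fun setT (fun x => complex.Re (h x)) /\
  measurable_fun setT (fun x => complex.Im (h x)).
have mcos : measurable_fun setT (@cos R) by apply: continuous_measurable_fun; exact: continuous_cos.
have msin : measurable_fun setT (@sin R) by apply: continuous_measurable_fun; exact: continuous_sin.
have mD h k : mC h -> mC k -> mC (fun x => h x + k x).
  move=> [h1 h2] [k1 k2]; split.
  - rewrite (_ : (fun x => _) = fun x => complex.Re (h x) + complex.Re (k x)).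
      exact: measurable_funD.
    by apply/funext => x; rewrite complex_ReD.
  - rewrite (_ : (fun x => _) = fun x => complex.Im (h x) + complex.Im (k x)).
      exact: measurable_funD.
    by apply/funext => x; rewrite complex_ImD.
have mM h k : mC h -> mC k -> mC (fun x => h x * k x).
  move=> [h1 h2] [k1 k2]; split.
  - rewrite (_ : (fun x => _) = fun x => complex.Re (h x) * complex.Re (k x) -
        complex.Im (h x) * complex.Im (k x)).
      by apply: measurable_funB; exact: measurable_funM.
    by apply/funext => x; rewrite complex_ReM.
  - rewrite (_ : (fun x => _) = fun x => complex.Re (h x) * complex.Im (k x) +
        complex.Im (h x) * complex.Re (k x)).
      by apply: measurable_funD; exact: measurable_funM.
    by apply/funext => x; rewrite complex_ImM.
have mc (k : C) : mC (fun=> k) by split; exact: measurable_cst.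
have m1 : mC (fun x => r%:C * expi x.1).
  apply: mM => //; split.
  - by apply: (measurableT_comp mcos); exact: measurable_fst.
  - by apply: (measurableT_comp msin); exact: measurable_fst.
have m2 : mC (fun x => r%:C * expi x.2).
  apply: mM => //; split.
  - by apply: (measurableT_comp mcos); exact: measurable_snd.
  - by apply: (measurableT_comp msin); exact: measurable_snd.
have mcmod h : mC h -> measurable_fun setT (fun x => cmod (h x)).
  move=> [h1 h2].
  rewrite (_ : (fun x => _) = Num.sqrt \o
      (fun x => complex.Re (h x) ^+ 2 + complex.Im (h x) ^+ 2)).
    apply: measurableT_comp; first by apply: continuous_measurable_fun; exact: sqrt_continuous.
    by apply: measurable_funD; exact: measurable_funX.
  by apply/funext => x; rewrite /= cmodE.
have mP P := mcmod _ (eval2_closed mc mD mM P m1 m2).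
have minv : measurable_fun setT (GRing.inv \o
    (fun x : R * R => cmod (eval2 B (r%:C * expi x.1) (r%:C * expi x.2)))).
  have m_inv : measurable_fun (`]0, +oo[ : set R) (@GRing.inv R).
    apply: open_continuous_measurable_fun; first exact: interval_open.
    move=> x; rewrite inE/= in_itv/= andbT => x0.
    by apply: inv_continuous; rewrite gt_eqF.
  apply: (measurable_comp _ _ m_inv (mP B)) => //.
  move=> _ [x _ <-] /=; rewrite in_itv/= andbT cmod_gt0.
  by have [] := gE _ _ (circle_bidisk x.1 x.2 r0 r1).
rewrite (_ : (fun x => _) = (fun x : R * R =>
    cmod (eval2 A (r%:C * expi x.1) (r%:C * expi x.2))) \* (GRing.inv \o
    (fun x : R * R => cmod (eval2 B (r%:C * expi x.1) (r%:C * expi x.2))))).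
  exact: (measurable_funM (mP A) minv).
apply/funext => x /=.
by have [_ ->] := gE _ _ (circle_bidisk x.1 x.2 r0 r1); rewrite cmodM cmodV.
Qed.

Lemma ReIm_continuous_circle (T : topologicalType) (a b : T -> R) (x : T) :
  {for x, continuous a} -> {for x, continuous b} ->
  ReIm_continuous_at x (fun y => (a y)%:C * expi (b y)).
Proof.
move=> ca cb; apply: ReIm_continuousM; split => /=.
- exact: ca.
- exact: cvg_cst.
- exact: (continuous_comp cb (@continuous_cos R _)).
- exact: (continuous_comp cb (@continuous_sin R _)).
Qed.

(** Covers the small radii, where the factor [r^-1] of [circle_L1] blows up: [|A| / |B|] is
    continuous on a compact set of parameters, because [B] has no zero in the bidisk. *)
Lemma rational_bounded_half g : rational_on_bidisk g ->
  exists M, forall r s t, 0 <= r <= 2^-1 -> 0 <= s <= 2 * pi -> 0 <= t <= 2 * pi ->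
    cmod (g (r%:C * expi s) (r%:C * expi t)) <= M.
Proof.
move=> [A [B gE]].
pose K := (`[0%R, 2^-1%R] `*` `[0%R, (2 * pi)%R]) `*` `[0%R, (2 * pi)%R] : set (R * R * R).
have pi0 : 0 <= 2 * pi :> R by rewrite mulr_ge0 ?pi_ge0.
have KE r s t : K (r, s, t) <-> [/\ 0 <= r <= 2^-1, 0 <= s <= 2 * pi & 0 <= t <= 2 * pi].
  by rewrite /K/= !in_itv/=; split => [[[]]|[]].
have cK : compact K.
  by apply: compact_setX; [apply: compact_setX|]; exact: segment_compact.
have K0 : K !=set0 by exists (0, 0, 0); apply/KE; split; lra.
pose F (P : {poly {poly C}}) (x : R * R * R) :=
  cmod (eval2 P (x.1.1%:C * expi x.1.2) (x.1.1%:C * expi x.2)).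
have cF P x : {for x, continuous (F P)}.
  apply: continuous_cmod.
  have c11 : {for x, continuous (fun y : R * R * R => y.1.1)}.
    by apply: (@continuous_comp _ _ _ fst fst x); exact: cvg_fst.
  have c12 : {for x, continuous (fun y : R * R * R => y.1.2)}.
    by apply: (@continuous_comp _ _ _ fst snd x); [exact: cvg_fst|exact: cvg_snd].
  have c2 : {for x, continuous (fun y : R * R * R => y.2)} by exact: cvg_snd.
  apply: (@eval2_closed R _ (@ReIm_continuous_at R _ x)).
  - by move=> c; exact: ReIm_continuous_cst.
  - by move=> h k; exact: ReIm_continuousD.
  - by move=> h k; exact: ReIm_continuousM.
  - exact: ReIm_continuous_circle.
  - exact: ReIm_continuous_circle.
have [|x xK xmax] := @compact_EVT_max _ R (fun x => F A x / F B x) K K0 cK.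
  apply: continuous_in_subspaceT => -[[r s] t]; rewrite inE => /KE[/andP[r0 rh] _ _].
  apply: cvgM; first exact: cF.
  apply: cvgV; last exact: cF.
  rewrite gt_eqF// cmod_gt0/=.
  have r1 : r < 1 by rewrite (le_lt_trans rh)// invf_lt1// ltr1n.
  by have [] := gE _ _ (circle_bidisk s t r0 r1).
exists (F A x / F B x) => r s t rh hs ht.
have := xmax (r, s, t); rewrite inE => /(_ ((KE _ _ _).2 (And3 rh hs ht))).
apply: le_trans.
case/andP: rh => r0 rh.
have r1 : r < 1 by rewrite (le_lt_trans rh)// invf_lt1// ltr1n.
by have [_ ->] := gE _ _ (circle_bidisk s t r0 r1); rewrite cmodM cmodV.
Qed.

End torus_regularity.

(** * Uniform bounds on the tori and membership in the Hardy space *)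

Section hardy_bound.
Context {R : realType}.
Local Notation C := R[i].
Local Notation mu := (@lebesgue_measure R).
Implicit Types (f g : C -> C -> C) (r s t M c : R).

Lemma measurable_slice_torus g r t : rational_on_bidisk g -> 0 <= r -> r < 1 ->
  measurable_fun [set: R] (fun s => cmod (g (r%:C * expi s) (r%:C * expi t))).
Proof.
move=> gr r0 r1.
exact: (measurableT_comp (measurable_cmod_torus gr r0 r1) (pair2_measurable t)).
Qed.

Lemma partial_z_circle_bound f : rational_on_bidisk f -> bounded_on_bidisk f ->
  exists c, forall r t, 0 < r < 1 -> 0 <= t <= 2 * pi ->
    (\int[mu]_(s in `[0%R, (2 * pi)%R])
       (cmod (partial_z f (r%:C * expi s) (r%:C * expi t)))%:E <= c%:E)%E.
Proof.
move=> fr [M fM].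
have pfr := rational_partial_z fr.
have [B hB] := rational_bounded_half pfr.
have [P [Q fE]] := fr.
(* This bounds the sizes of all slices, whatever [r] and [t]. The leading [2] in [c1] bounds [r^-1]
   for [r > 1/2]. *)
pose n := maxn (size P) (size Q).
pose c1 := 2 * ((4 * n)%N.+1%:R * (4 * M)).
have pi0 : 0 <= 2 * pi :> R by rewrite mulr_ge0 ?pi_ge0.
have zero_bidisk : bidisk (0 : C) 0 by split; rewrite normr0 ltr01.
have M0 : 0 <= M := le_trans (cmod_ge0 _) (fM _ _ zero_bidisk).
exists (Num.max c1 (B * (2 * pi))) => r t /andP[r0 r1] ht.
have bd s := circle_bidisk s t (ltW r0) r1.
(* Small radii use the pointwise bound [B] of the partial derivative, larger ones the variation
   bound. *)
have [rh|rh] := leP r 2^-1.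
  apply: (@le_trans _ _ (\int[mu]_(s in `[0%R, (2 * pi)%R]) B%:E)%E).
    apply: ge0_le_integral => //.
    - by move=> s _; rewrite lee_fin cmod_ge0.
    - apply/measurable_EFinP; apply: measurable_funTS.
      exact: measurable_slice_torus (ltW r0) r1.
    - move=> s; rewrite /= in_itv/= => hs; rewrite lee_fin; apply: hB => //.
      by rewrite ltW.
  by rewrite integral_cst_2pi lee_fin le_max lexx orbT.
rewrite (@eq_integral _ _ _ mu _ (fun s => (cmod (
   ((slice P (r%:C * expi t))^`() * slice Q (r%:C * expi t) -
    slice P (r%:C * expi t) * (slice Q (r%:C * expi t))^`()).[r%:C * expi s] /
   (slice Q (r%:C * expi t) ^+ 2).[r%:C * expi s]))%:E)); last first.
  by move=> s _; rewrite (partial_z_slice fE (bd s)).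
have sS (S : {poly {poly C}}) : (size S <= n)%N -> (size (slice S (r%:C * expi t)%R) <= n.+1)%N.
  by move=> h; rewrite (leq_trans (size_slice _ _))// leqW.
apply: (le_trans (@circle_L1 R n r M _ _ r0 (sS _ _) (sS _ _) _ _)).
- exact: leq_maxl.
- exact: leq_maxr.
- by move=> s; rewrite horner_slice; have [] := fE _ _ (bd s).
- by move=> s; rewrite !horner_slice; have [_ <-] := fE _ _ (bd s); exact: fM.
rewrite lee_fin le_max; apply/orP; left; rewrite /c1 ler_wpM2r//.
  by rewrite mulr_ge0// mulr_ge0.
by rewrite -[leRHS]invrK lef_pV2 ?posrE ?invr_gt0// ltW.
Qed.

Lemma H1_partial_z f : rational_on_bidisk f -> bounded_on_bidisk f ->
  H1_bidisk (partial_z f).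
Proof.
move=> fr fb; have pfr := rational_partial_z fr.
split; first exact: rational_analytic.
have [c hc] := partial_z_circle_bound fr fb.
exists ((4 * pi ^+ 2)^-1 * (c * (2 * pi))) => r r01; have /andP[r0 r1] := r01.
rewrite /torus_L1_norm EFinM lee_wpmul2l//.
  by rewrite lee_fin invr_ge0 mulr_ge0// sqr_ge0.
apply: integral_square_le2.
- by move=> x; exact: cmod_ge0.
- exact: measurable_cmod_torus pfr (ltW r0) r1.
- by move=> t ht; exact: hc.
Qed.

(** [partial_w f z w] is by conversion [partial_z fT w z] for the swapped function [fT], so the
    circle bound for [fT] controls the integral in the second angle with the first one fixed. *)
Lemma H1_partial_w f : rational_on_bidisk f -> bounded_on_bidisk f ->
  H1_bidisk (partial_w f).
Proof.
move=> fr [M fM]; pose fT z w := f w z.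
have fTr : rational_on_bidisk fT := rational_swap fr.
have fTb : bounded_on_bidisk fT by exists M => z w [z1 w1]; exact: fM.
have pwr : rational_on_bidisk (partial_w f) := rational_swap (rational_partial_z fTr).
split; first exact: rational_analytic.
have [c hc] := partial_z_circle_bound fTr fTb.
exists ((4 * pi ^+ 2)^-1 * (c * (2 * pi))) => r r01; have /andP[r0 r1] := r01.
rewrite /torus_L1_norm EFinM lee_wpmul2l//.
  by rewrite lee_fin invr_ge0 mulr_ge0// sqr_ge0.
apply: integral_square_le1.
- by move=> x; exact: cmod_ge0.
- exact: measurable_cmod_torus pwr (ltW r0) r1.
- by move=> s hs; exact: hc.
Qed.

End hardy_bound.

Theorem theorem1p5 (R : realType) (f : R[i] -> R[i] -> R[i]) :
  rational_on_bidisk f -> bounded_on_bidisk f ->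
  H1_bidisk (partial_z f) /\ H1_bidisk (partial_w f).
Proof. by move=> fr fb; split; [exact: H1_partial_z|exact: H1_partial_w]. Qed.
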